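(* Let $(M,\mathcal Q)$ be an almost quaternionic manifold and let $\nabla$ and $\nabla'$ be two different quaternionic connections on it, with torsion tensors $T^{\nabla}$ and $T^{\nabla'}$, respectively. The following conditions are equivalent: (i) the two almost complex structures $I_1^{\nabla}$ and $I_1^{\nabla'}$ on the twistor space $Z$ coincide; (ii) the $(0,2)_J$-parts of the torsions $T^{\nabla}$ and $T^{\nabla'}$ coincide with respect to all almost complex structures $J\in\mathcal Q$, i.e. $(T^{\nabla})^{0,2}_J=(T^{\nabla'})^{0,2}_J$ for all $J\in\mathcal Q$ with $J^2=-\mathrm{id}$.
   Context: An almost quaternionic structure on a $4n$-dimensional manifold $M$ ($n\ge 1$) is a rank-3 subbundle $\mathcal Q\subset \mathrm{End}(TM)$ which is locally spanned by triples $(J_1,J_2,J_3)$ of almost complex structures with $J_\alpha^2=-\mathrm{id}$ and $J_1J_2=-J_2J_1=J_3$; such a local triple is called an admissible basis of $\mathcal Q$. $(M,\mathcal Q)$ is then called an almost quaternionic manifold. A quaternionic connection is a linear connection $\nabla$ on $TM$ preserving $\mathcal Q$, i.e. $\nabla_X\sigma\in\Gamma(\mathcal Q)$ for every vector field $X$ and every $\sigma\in\Gamma(\mathcal Q)$; no assumption is made on its torsion. For a $TM$-valued 2-form $B$ and $J\in\mathcal Q$ with $J^2=-\mathrm{id}$, the $(0,2)_J$-part of $B$ is $$B^{0,2}_J(X,Y)=\tfrac14\big(B(JX,JY)-B(X,Y)-JB(JX,Y)-JB(X,JY)\big).$$ Twistor space: $Z=\{J\in\mathcal Q: J^2=-\mathrm{id}\}$,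 i.e. the $S^2$-bundle $\pi:Z\to M$ whose elements are locally $J=a_1J_1+a_2J_2+a_3J_3$ with $a_1^2+a_2^2+a_3^2=1$. For $J\in Z$ with $\pi(J)=x$, the vertical space is $V_J=\ker \pi_{*}=\{W\in\mathcal Q_x: WJ+JW=0\}$. A quaternionic connection $\nabla$ induces a connection on the vector bundle $\mathcal Q$ which preserves $Z$, hence a horizontal distribution $H$ on $Z$ with $T_JZ=V_J\oplus H_J$ and $\pi_*:H_J\to T_xM$ an isomorphism. For $Y\in T_xM$ let $Y^h\in H_J$ denote its horizontal lift. The almost complex structure $I_1^\nabla$ on $Z$ is defined at $J\in Z$ by $I_1^\nabla(W)=JW$ for $W\in V_J$ and $I_1^\nabla(Y^h)=(JY)^h$ for $Y\in T_xM$. *)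

(* Defs.v *)
From HB Require Import structures.
From mathcomp Require Import all_boot all_order all_algebra.
From mathcomp Require Import all_classical all_reals all_analysis.

Set Implicit Arguments.
Unset Strict Implicit.
Unset Printing Implicit Defensive.

Import Order.TTheory GRing.Theory Num.Theory.
Import numFieldNormedType.Exports.

Local Open Scope classical_set_scope.
Local Open Scope ring_scope.

(** [f] is C^k on the open set [U].  In finite dimension this is the usual
    notion: C^(k+1) iff differentiable with all directional derivatives C^k. *)
Fixpoint Ck_on (R : realType) (V W : normedModType R) (k : nat)
    (U : set V) (f : V -> W) : Prop :=
  if k is k'.+1 then
    (forall x, U x -> differentiable f x) /\
    (forall v, Ck_on k' U (fun x => 'd f x v))
  else forall x, U x -> {for x, continuous f}.

Definition smooth_on (R : realType) (V W : normedModType R)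
    (U : set V) (f : V -> W) : Prop := forall k, Ck_on k U f.

Definition smooth_at (R : realType) (V W : normedModType R)
    (x : V) (f : V -> W) : Prop :=
  exists2 U : set V, open_nbhs x U & smooth_on U f.

(** The matrix of a linear endomorphism, acting on column vectors on the left,
    so that composition of endomorphisms is [*m]. *)
Definition colmx_of (R : realType) (m : nat) (f : 'cV[R]_m -> 'cV[R]_m)
    : 'M[R]_m := \matrix_(i, j) f (delta_mx j 0) i 0.

(** Total functions are used for the chart and its inverse; their values
    outside [cdom] and [cto @` cdom] are irrelevant. *)
Record chart (R : realType) (m : nat) (M : topologicalType) := Chart {
  cdom : set M;
  cto : M -> 'cV[R]_m;
  cfrom : 'cV[R]_m -> M;
  cdom_open : open cdom;
  cimg_open : open (cto @` cdom);
  ctoK : forall p, cdom p -> cfrom (cto p) = p;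
  cto_continuous : forall p, cdom p -> {for p, continuous cto};
  cfrom_continuous : forall z, (cto @` cdom) z -> {for z, continuous cfrom}
}.

(** A smooth m-manifold; the smooth structure is the one generated by the
    atlas [chart_at], which is indexed by the points of the manifold.
    Indexing the atlas this way selects a preferred chart around each point
    and is no loss of generality. *)
Record smooth_manifold (R : realType) (m : nat) := SmoothManifold {
  carrier :> topologicalType;
  carrier_hausdorff : hausdorff_space carrier;
  carrier_second_countable : @second_countable carrier;
  chart_at : carrier -> chart R m carrier;
  chart_atP : forall x, cdom (chart_at x) x;
  chart_compat : forall x y,
    smooth_on (cto (chart_at x) @` (cdom (chart_at x) `&` cdom (chart_at y)))
              (cto (chart_at y) \o cfrom (chart_at x))
}.

(** The tangent space T_x M is 'cV[R]_m, a tangent vector at x being given by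
    its components in the preferred chart at x; End(T_x M) is 'M[R]_m.
    Hence a vector field is a function M -> 'cV[R]_m and a field of
    endomorphisms of TM a function M -> 'M[R]_m.  Such values at different
    points refer to different charts; they are compared through the Jacobians
    [cchange] below. *)

Section Calculus.
Context {R : realType} {m : nat} {M : smooth_manifold R m}.
Implicit Types (x y p : M) (v w : 'cV[R]_m) (z : 'cV[R]_m) (A J : 'M[R]_m).
Implicit Types (X Y : M -> 'cV[R]_m) (sigma : M -> 'M[R]_m).

Definition cdom_at x : set M := cdom (chart_at x).
Definition cto_at x : M -> 'cV[R]_m := cto (chart_at x).
Definition cfrom_at x : 'cV[R]_m -> M := cfrom (chart_at x).

(** Change of components of tangent vectors at [p], from those in the chart
    at [x] to those in the chart at [y]. *)
Definition cchange x y p : 'M[R]_m :=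
  colmx_of ('d (cto_at y \o cfrom_at x) (cto_at x p)).

(** Components, in the chart at [x], of [v] in T_p M and of [A] in
    End(T_p M). *)
Definition vcoord x p v : 'cV[R]_m := cchange p x p *m v.
Definition ecoord x p A : 'M[R]_m := cchange p x p *m A *m cchange x p p.

(** Expressions of functions, vector fields and endomorphism fields in the
    chart at [x]. *)
Definition floc x (f : M -> R) z : R := f (cfrom_at x z).
Definition vloc x X z : 'cV[R]_m := vcoord x (cfrom_at x z) (X (cfrom_at x z)).
Definition eloc x sigma z : 'M[R]_m :=
  ecoord x (cfrom_at x z) (sigma (cfrom_at x z)).

Definition fsmooth_at x (f : M -> R) := smooth_at (cto_at x x) (floc x f).
Definition vsmooth_at x X := smooth_at (cto_at x x) (vloc x X).
Definition esmooth_at x sigma := smooth_at (cto_at x x) (eloc x sigma).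

Definition fderiv x (f : M -> R) v : R := 'd (floc x f) (cto_at x x) v.

Definition lie_bracket X Y x : 'cV[R]_m :=
  'd (vloc x Y) (cto_at x x) (X x) - 'd (vloc x X) (cto_at x x) (Y x).

(** The vector field with constant components [v] in the chart at [x]: an
    extension of [v] in T_x M to a smooth vector field near [x]. *)
Definition vext x v : M -> 'cV[R]_m := fun p => cchange x p p *m v.

End Calculus.

(** Connections are taken as operators on local sections: [cov x v Y] is the
    covariant derivative at [x], in the direction of [v] in T_x M, of a vector
    field [Y] smooth near [x].  For other [Y] the value is irrelevant. *)
Record connection (R : realType) (m : nat) (M : smooth_manifold R m) :=
  Connection {
  cov : forall x : M, 'cV[R]_m -> (M -> 'cV[R]_m) -> 'cV[R]_m;
  cov_local : forall x v (Y Z : M -> 'cV[R]_m),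
    vsmooth_at x Y -> vsmooth_at x Z -> (\forall y \near x, Y y = Z y) ->
    cov x v Y = cov x v Z;
  cov_linear : forall x (Y : M -> 'cV[R]_m), vsmooth_at x Y ->
    forall (a : R) v w, cov x (a *: v + w) Y = a *: cov x v Y + cov x w Y;
  cov_add : forall x v (Y Z : M -> 'cV[R]_m),
    vsmooth_at x Y -> vsmooth_at x Z ->
    cov x v (fun y => Y y + Z y) = cov x v Y + cov x v Z;
  cov_leibniz : forall x v (f : M -> R) (Y : M -> 'cV[R]_m),
    fsmooth_at x f -> vsmooth_at x Y ->
    cov x v (fun y => f y *: Y y) = fderiv x f v *: Y x + f x *: cov x v Y;
  cov_smooth : forall x (X Y : M -> 'cV[R]_m),
    vsmooth_at x X -> vsmooth_at x Y ->
    vsmooth_at x (fun y => cov y (X y) Y)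
}.

(** A tangent vector of the total space of End(TM) at a point over [x] is a
    pair (v, W) of components in the trivialisation given by the chart at [x]:
    [v] is its projection to T_x M, and the vertical vectors are the (0, W)
    with W in End(T_x M). *)
Definition etangent (R : realType) (m : nat) : Type := ('cV[R]_m * 'M[R]_m)%type.

Section Quaternionic.
Context {R : realType} {m : nat} {M : smooth_manifold R m}.
Implicit Types (x : M) (v w : 'cV[R]_m).
Implicit Types (nabla : connection M) (sigma : M -> 'M[R]_m).
Implicit Types (Q : M -> set 'M[R]_m).

(** Only values on smooth vector fields are meaningful. *)
Definition same_connection nabla nabla' : Prop :=
  forall x v (Y : M -> 'cV[R]_m),
    vsmooth_at x Y -> cov nabla x v Y = cov nabla' x v Y.

Definition torsion_fields nabla (X Y : M -> 'cV[R]_m) x : 'cV[R]_m :=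
  cov nabla x (X x) Y - cov nabla x (Y x) X - lie_bracket X Y x.

(** The torsion tensor at [x]; by tensoriality it does not depend on the
    fields used to extend [v] and [w]. *)
Definition torsion nabla x v w : 'cV[R]_m :=
  torsion_fields nabla (vext x v) (vext x w) x.

(** The induced connection on End(TM):
    (nabla_v sigma) W = nabla_v (sigma W) - sigma (nabla_v W), where the value
    at [w] in T_x M is computed with the extension [W] = [vext x w]. *)
Definition ecov nabla x v sigma : 'M[R]_m :=
  colmx_of (fun w =>
    cov nabla x v (fun y => sigma y *m vext x w y)
    - sigma x *m cov nabla x v (vext x w)).

Definition admissible_basis Q (U : set M) (J1 J2 J3 : M -> 'M[R]_m) : Prop :=
  forall y, U y ->
  [/\ [/\ esmooth_at y J1, esmooth_at y J2 & esmooth_at y J3],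
      [/\ J1 y *m J1 y = - 1%:M, J2 y *m J2 y = - 1%:M
        & J3 y *m J3 y = - 1%:M],
      J1 y *m J2 y = J3 y, J2 y *m J1 y = - J3 y
    & Q y = [set A | exists a b c : R,
                     A = a *: J1 y + b *: J2 y + c *: J3 y]].

(** The quaternionic relations make [J1], [J2], [J3] linearly independent (for
    m > 0), so [Q] is a smooth subbundle of rank 3. *)
Definition almost_quaternionic Q : Prop :=
  forall x, exists2 U : set M, open_nbhs x U &
  exists J1 J2 J3, admissible_basis Q U J1 J2 J3.

Definition local_section Q x sigma : Prop :=
  esmooth_at x sigma /\ \forall y \near x, Q y (sigma y).

Definition quaternionic_connection Q nabla : Prop :=
  forall x v sigma, local_section Q x sigma -> Q x (ecov nabla x v sigma).

(** (0,2)_J-part of a T_x M-valued bilinear map. *)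
Definition part02 (J : 'M[R]_m) (B : 'cV[R]_m -> 'cV[R]_m -> 'cV[R]_m)
    (v w : 'cV[R]_m) : 'cV[R]_m :=
  (4%:R)^-1 *: (B (J *m v) (J *m w) - B v w
                - J *m B (J *m v) w - J *m B v (J *m w)).

Definition twistor Q x : set 'M[R]_m :=
  [set J | Q x J /\ J *m J = - 1%:M].

(** T_J Z: the velocities at time 0 of smooth curves t |-> (g t, c t) in the
    twistor space starting at (x, J). *)
Definition twistor_tangent Q x (J : 'M[R]_m) : set (etangent R m) :=
  [set xi | exists (g : R -> M) (c : R -> 'M[R]_m),
    let gx := fun t : R => cto_at x (g t) in
    let cx := fun t : R => ecoord x (g t) (c t) in
    [/\ g 0 = x, c 0 = J,
        \forall t \near (0 : R), cdom_at x (g t) /\ twistor Q (g t) (c t),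
        smooth_at (0 : R) gx /\ smooth_at (0 : R) cx
      & xi = (derive1 gx 0, derive1 cx 0)]].

(** The differential at [x] of [sigma], seen as a map from M to the total
    space of End(TM). *)
Definition section_diff x sigma v : etangent R m :=
  (v, 'd (eloc x sigma) (cto_at x x) v).

(** [xi] is horizontal at [J]: it is tangent to a section of [Q] through [J]
    which is parallel at [x] in the direction of the projection of [xi]. *)
Definition horizontal Q nabla x (J : 'M[R]_m) : set (etangent R m) :=
  [set xi | exists sigma,
    [/\ local_section Q x sigma, sigma x = J,
        ecov nabla x xi.1 sigma = 0 & xi = section_diff x sigma xi.1]].

(** The horizontal lift: the (unique) horizontal vector over [v]. *)
Definition hlift Q nabla x (J : 'M[R]_m) v : etangent R m :=
  xget (v, 0) [set xi | horizontal Q nabla x J xi /\ xi.1 = v].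

(** The almost complex structure I_1 at [J]: the linear map with
    (0, W) |-> (0, J W) on vertical vectors and Y^h |-> (J Y)^h on horizontal
    lifts, written through the decomposition [xi] = W + Y^h where Y is the
    projection of [xi]. *)
Definition twistor_I1 Q nabla x (J : 'M[R]_m) (xi : etangent R m) : etangent R m :=
  (0, J *m (xi - hlift Q nabla x J xi.1).2)
  + hlift Q nabla x J (J *m xi.1).

End Quaternionic.

(* Main.v *)
Require Import Defs.
From HB Require Import structures.
From mathcomp Require Import all_boot all_order all_algebra.
From mathcomp Require Import all_classical all_reals all_analysis.
From mathcomp Require Import ring.
Import Order.TTheory GRing.Theory Num.Theory.
Import numFieldNormedType.Exports.
Local Open Scope classical_set_scope.
Local Open Scope ring_scope.

Set Implicit Arguments.
Unset Strict Implicit.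
Unset Printing Implicit Defensive.

(** Everything is pointwise over [M].  In the chart at [x] a connection is the
    flat derivative plus the endomorphism-valued form
    [G v = christoffel nabla x v], and this alone enters both conditions.

    The horizontal lift of [v] at [J] is [(v, - commx (G v) J)] ([hliftE]), so
    that [I_1 xi = (J xi.1, J xi.2 - P xi.1)] with
      [P v = commx (G (J v)) J - J (commx (G v) J)],
    called [twist_obstruction J G v] below ([twistor_I1E]).  As every [v] is the
    projection of a vector tangent to the twistor space
    ([twistor_tangent_over]), the two structures [I_1] agree at [J] iff
    the two connections have the same [P].  On the other side the torsion is
    [G v w - G w v], and expanding its (0,2)-part with [J^2 = -1] gives
    [4 T^{0,2}(v, w) = P v w - P w v] ([part02_torsion_obstruction]).  Hence
    (i) implies (ii).

    For the converse, let [P] now be the difference of the two obstructions,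
    that is, the obstruction of the difference [S] of the two forms [G].  Since
    both connections preserve [Q], [commx (S v) A] is in [Q] for [A] in [Q]
    ([christoffel_sub_commx]), and it follows that [P v] is in [Q]
    ([twist_obstruction_qspan]).  Condition (ii) says [P v w = P w v].  An
    element of [Q] squares to a nonpositive scalar, which vanishes only for the
    element 0.  If [P v] were nonzero it would therefore be invertible; with [w]
    such that [P v w = v], also [P w v = v], and then [(P w)^2 v = v]
    forces [v = 0]; but then [P v u = P u v = 0] for all [u]
    ([symmetric_qspan_eq0]). *)

(** * Calculus of smooth maps between normed spaces *)

Lemma is_diffE (R : realType) (V W : normedModType R) (f df : V -> W) (x : V) :
  is_diff x f df -> 'd f x = df :> (V -> W).
Proof. by case. Qed.

Lemma is_diff_near_eq (R : realType) (V W : normedModType R) (f g df : V -> W)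
    (x : V) :
  (\forall y \near x, f y = g y) -> is_diff x f df -> is_diff x g df.
Proof.
move=> fg [fdiff <-].
have fgx : f x = g x by exact: nbhs_singleton fg.
have [dfc /eqaddoP dfE] := (diff_locallyP _ _).1 fdiff.
have gE : g \o shift x = cst (g x) + 'd f x +o_ (0 : V) id.
  apply/eqaddoP => e e0; move: (dfE e e0); rewrite -fgx.
  have : \forall h \near (0 : V), f (h + x) = g (h + x).
    by move: fg; rewrite (near_shift 0) /= subr0; apply.
  apply: filterS2 => h fgh.
  by rewrite !fctE /= fgh.
have dgE := diff_unique dfc gE.
split; last exact: dgE.
by apply/diff_locallyP; rewrite dgE; split; [exact: dfc|exact: gE].
Qed.

(** Scaling is a continuous bilinear map [R * W -> W], so this is the chain
    rule for it. *)
Lemma is_diff_scale (R : realType) (V W : normedModType R) (f df : V -> R)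
    (F dF : V -> W) (x : V) :
  is_diff x f df -> is_diff x F dF ->
  is_diff x (fun z => f z *: F z) (fun v => f x *: dF v + df v *: F x).
Proof.
move=> fd Fd.
have bilin : bilinear_for (GRing.Scale.Law.clone _ _ *:%R _)
    (GRing.Scale.Law.clone _ _ *:%R _) (fun (a : R) (w : W) => a *: w).
  split=> [u'|u] a y z /=; first by rewrite scalerDl scalerA.
  by rewrite scalerDr scalerA mulrC -scalerA.
pose scM := bilinear_isBilinear.Build R R W W _ _ _ bilin.
pose sc : {bilinear R -> W -> W} := HB.pack (fun (a : R) (w : W) => a *: w) scM.
have scc : continuous (fun p : R * W => sc p.1 p.2).
  by move=> p; exact: scale_continuous.
have scd : is_diff (f x, F x) (fun p : R * W => sc p.1 p.2)
    (fun p : R * W => sc (f x) p.2 + sc p.1 (F x)).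
  split; first exact: differentiable_bilin.
  exact: (@diff_bilin _ _ _ _ sc (f x, F x)).
exact: (@is_diff_comp _ _ _ _ (fun z => (f z, F z)) (fun v => (df v, dF v))
  (fun p : R * W => sc p.1 p.2) _ x _ scd).
Qed.

Section SmoothCalculus.
Context {R : realType}.
Implicit Types (U V W : normedModType R).

Lemma is_diff_linear_comp V W W' (L : {linear W -> W'}) (f df : V -> W) x :
  continuous L -> is_diff x f df -> is_diff x (L \o f) (L \o df).
Proof.
move=> Lc fd; apply: is_diff_comp.
split; [exact: linear_differentiable|exact: diff_lin].
Qed.

Lemma Ck_on_subset k V W (A B : set V) (f : V -> W) :
  A `<=` B -> Ck_on k B f -> Ck_on k A f.
Proof.
elim: k f => [|k IH] f AB /=; first by move=> H x /AB /H.
by move=> [fd fC]; split=> [x /AB /fd //|v]; exact: IH (fC v).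
Qed.

(** The set is open so that two maps agreeing on it have the same differentials
    on it. *)
Lemma Ck_on_congr k V W (A : set V) (f g : V -> W) :
  open A -> (forall x, A x -> f x = g x) -> Ck_on k A f -> Ck_on k A g.
Proof.
elim: k f g => [|k IH] f g oA fg /=.
  move=> fc x Ax; change (g @ x --> g x); rewrite -(fg x Ax).
  apply: cvg_trans (fc x Ax); apply: near_eq_cvg.
  by near=> y; apply: fg; near: y; exact: open_nbhs_nbhs.
move=> [fd fC].
have gd x : A x -> is_diff x g ('d f x).
  move=> Ax; apply: is_diff_near_eq (differentiableP (fd x Ax)).
  by near=> y; apply: fg; near: y; exact: open_nbhs_nbhs.
split=> [x /gd [gdx _]|v]; first exact: gdx.
apply: IH oA _ (fC v) => x Ax.
exact: esym (congr1 (fun h => h v) (is_diffE (gd x Ax))).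
Unshelve. all: by end_near. Qed.

Lemma Ck_on_linear k V W W' (L : {linear W -> W'}) (A : set V) (f : V -> W) :
  open A -> continuous L -> Ck_on k A f -> Ck_on k A (L \o f).
Proof.
move=> oA Lc; elim: k f => [|k IH] f /=.
  by move=> fc x Ax; apply: continuous_comp (fc x Ax) _; exact: Lc.
move=> [fd fC].
have Ld x : A x -> is_diff x (L \o f) (L \o 'd f x).
  by move=> Ax; apply: is_diff_linear_comp (differentiableP (fd x Ax)).
split=> [x /Ld [] //|v].
apply: Ck_on_congr (IH _ (fC v)) => // x Ax.
exact: esym (congr1 (fun h => h v) (is_diffE (Ld x Ax))).
Qed.

Lemma Ck_on_add k V W (A : set V) (f g : V -> W) :
  open A -> Ck_on k A f -> Ck_on k A g -> Ck_on k A (fun x => f x + g x).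
Proof.
move=> oA; elim: k f g => [|k IH] f g /=.
  by move=> fc gc x Ax; apply: continuousD; [exact: fc|exact: gc].
move=> [fd fC] [gd gC].
have Dd x : A x -> is_diff x (fun x => f x + g x) ('d f x \+ 'd g x).
  move=> Ax; have := differentiableP (gd x Ax).
  exact: is_diffD (differentiableP (fd x Ax)).
split=> [x /Dd [] //|v].
apply: Ck_on_congr (IH _ _ (fC v) (gC v)) => // x Ax.
exact: esym (congr1 (fun h => h v) (is_diffE (Dd x Ax))).
Qed.

Lemma smooth_on_diff V W (A : set V) (f : V -> W) v :
  smooth_on A f -> smooth_on A (fun x => 'd f x v).
Proof. by move=> fs k; exact: (fs k.+1).2. Qed.

(** Smoothness, and not just C^k, is assumed of both factors, so that the
    induction applies to the products of a factor with a derivative of the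
    other. *)
Lemma Ck_on_scale k V W (A : set V) (f : V -> R) (F : V -> W) :
  open A -> smooth_on A f -> smooth_on A F ->
  Ck_on k A (fun x => f x *: F x).
Proof.
move=> oA; elim: k f F => [|k IH] f F fs Fs /=.
  by move=> x Ax; apply: cvgZ; [exact: (fs 0%N x Ax)|exact: (Fs 0%N x Ax)].
have sd x : A x ->
    is_diff x (fun x => f x *: F x) (fun v => f x *: 'd F x v + 'd f x v *: F x).
  move=> Ax; apply: is_diff_scale; apply: differentiableP.
    exact: ((fs 1%N).1 x Ax).
  exact: ((Fs 1%N).1 x Ax).
split=> [x /sd [] //|v].
apply: (@Ck_on_congr _ _ _ _
  (fun x => f x *: 'd F x v + 'd f x v *: F x)) => // [x Ax|].
  exact: esym (congr1 (fun h => h v) (is_diffE (sd x Ax))).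
apply: Ck_on_add => //; apply: IH => //; exact: smooth_on_diff.
Qed.

Lemma Ck_on_cst k V W (A : set V) (w : W) : Ck_on k A (fun=> w).
Proof.
elim: k w => [|k IH] w /=; first by move=> x _; exact: cst_continuous.
split=> [x _|v]; first exact: differentiable_cst.
rewrite (_ : (fun x => _) = fun=> 0) //; apply/funext => x.
by rewrite diff_cst.
Qed.

Lemma is_diff_cst_add_linear V W (w : W) (L : {linear V -> W}) x :
  continuous L -> is_diff x (fun z => w + L z) L.
Proof.
move=> Lc.
have Ld : is_diff x L L.
  by split; [exact: linear_differentiable|exact: diff_lin].
have := @is_diffD _ _ _ (cst w) L 0 L x _ Ld.
by rewrite add0r; apply.
Qed.

Lemma Ck_on_cst_add_linear k V W (A : set V) (w : W) (L : {linear V -> W}) :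
  continuous L -> Ck_on k A (fun z => w + L z).
Proof.
move=> Lc; have Ld x := @is_diff_cst_add_linear V W w L x Lc.
case: k => [|k] /=.
  by move=> x _; apply: differentiable_continuous.
split=> [x _|v]; first exact: ex_diff.
rewrite (_ : (fun x => _) = fun=> L v); first exact: Ck_on_cst.
by apply/funext => x; rewrite diff_val.
Qed.

Lemma Ck_on_comp_affine k V V' W (A : set V') (f : V' -> W) (a : V')
    (L : {linear V -> V'}) :
  continuous L -> open A -> Ck_on k A f ->
  Ck_on k ((fun z => a + L z) @^-1` A) (fun z => f (a + L z)).
Proof.
move=> Lc oA; have Ld x := @is_diff_cst_add_linear V V' a L x Lc.
have Lac : continuous (fun z => a + L z).
  by move=> x; apply: differentiable_continuous.
have oB : open ((fun z => a + L z) @^-1` A).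
  by apply: open_comp => // x _; exact: Lac.
elim: k f => [|k IH] f /=.
  by move=> fc x Ax; apply: continuous_comp; [exact: Lac|exact: fc].
move=> [fd fC].
have cd x : A (a + L x) -> is_diff x (fun z => f (a + L z)) ('d f (a + L x) \o L).
  move=> Ax; exact: (@is_diff_comp _ _ _ _ (fun z => a + L z) _ f _ x _
    (differentiableP (fd _ Ax))).
split=> [x /cd [] //|v].
apply: Ck_on_congr (IH _ (fC (L v))) => // x Ax.
exact: esym (congr1 (fun h => h v) (is_diffE (cd x Ax))).
Qed.

End SmoothCalculus.

Section SmoothAt.
Context {R : realType}.
Implicit Types (U V W : normedModType R).

Lemma smooth_at_near_eq V W (f g : V -> W) x :
  (\forall y \near x, f y = g y) -> smooth_at x f -> smooth_at x g.
Proof.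
move=> fg [A [oA Ax] fs].
exists (A `&` interior [set y | f y = g y]).
  by split; [apply: openI => //; exact: open_interior|split].
move=> k; apply: (Ck_on_congr (f := f)); last exact: Ck_on_subset (fs k).
  by apply: openI => //; exact: open_interior.
by move=> y [_ /interior_subset].
Qed.

Lemma smooth_at_eq V W (f g : V -> W) x :
  (forall y, f y = g y) -> smooth_at x f -> smooth_at x g.
Proof. by move=> /funext ->. Qed.

Lemma smooth_at_linear V W W' (L : {linear W -> W'}) (f : V -> W) x :
  continuous L -> smooth_at x f -> smooth_at x (L \o f).
Proof.
by move=> Lc [A [oA Ax] fs]; exists A => // k; exact: Ck_on_linear.
Qed.

Lemma smooth_at_add V W (f g : V -> W) x :
  smooth_at x f -> smooth_at x g -> smooth_at x (fun z => f z + g z).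
Proof.
move=> [A [oA Ax] fs] [B [oB Bx] gs]; exists (A `&` B).
  by split=> //; exact: openI.
by move=> k; apply: Ck_on_add; [exact: openI
  |apply: Ck_on_subset (fs k)|apply: Ck_on_subset (gs k)].
Qed.

Lemma smooth_at_scale V W (f : V -> R) (F : V -> W) x :
  smooth_at x f -> smooth_at x F -> smooth_at x (fun z => f z *: F z).
Proof.
move=> [A [oA Ax] fs] [B [oB Bx] Fs]; exists (A `&` B).
  by split=> //; exact: openI.
move=> k; apply: Ck_on_scale; first exact: openI.
  by move=> j; apply: Ck_on_subset (fs j).
by move=> j; apply: Ck_on_subset (Fs j).
Qed.

Lemma smooth_at_cst V W (w : W) (x : V) : smooth_at x (fun=> w).
Proof.
exists setT; first by split=> //; exact: openT.
by move=> k; exact: Ck_on_cst.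
Qed.

Lemma smooth_at_cst_add_linear V W (w : W) (L : {linear V -> W}) x :
  continuous L -> smooth_at x (fun z => w + L z).
Proof.
move=> Lc; exists setT; first by split=> //; exact: openT.
by move=> k; exact: Ck_on_cst_add_linear.
Qed.

Lemma smooth_at_comp_affine V V' W (f : V' -> W) (a : V')
    (L : {linear V -> V'}) x :
  continuous L -> smooth_at (a + L x) f -> smooth_at x (fun z => f (a + L z)).
Proof.
move=> Lc [A [oA Ax] fs]; exists ((fun z => a + L z) @^-1` A).
  split=> //; apply: open_comp => // y _.
  by apply: differentiable_continuous; have [] := is_diff_cst_add_linear a y Lc.
by move=> k; exact: Ck_on_comp_affine.
Qed.

Lemma smooth_at_is_diff V W (f : V -> W) x : smooth_at x f -> is_diff x f ('d f x).
Proof.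
by move=> [A [oA Ax] fs]; apply: differentiableP; exact: ((fs 1%N).1 x Ax).
Qed.

(** Finite dimension: a linear map is a finite combination of entries. *)
Lemma matrix_linear_continuous p q W (L : {linear 'M[R]_(p, q) -> W}) :
  continuous L.
Proof.
move=> A; apply: differentiable_continuous.
have -> : (L : _ -> _) =
    \sum_(i < p) \sum_(j < q) (fun B : 'M[R]_(p, q) => B i j *: L (delta_mx i j)).
  apply/funext => B; rewrite [in LHS](matrix_sum_delta B) linear_sum fct_sumE.
  apply: eq_bigr => i _; rewrite linear_sum fct_sumE.
  by apply: eq_bigr => j _; rewrite linearZ.
apply: differentiable_sum => i; apply: differentiable_sum => j.
by apply: differentiableZl; exact: differentiable_coord.
Qed.

End SmoothAt.

Section ColumnMatrix.
Context {R : realType} {m : nat}.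

Definition mxentry p q i j (A : 'M[R]_(p, q)) : R := A i j.

Lemma mxentry_is_linear p q i j : linear (@mxentry p q i j).
Proof. by move=> a A B; rewrite /mxentry !mxE. Qed.

HB.instance Definition _ p q i j :=
  GRing.isLinear.Build R 'M[R]_(p, q) R _ (@mxentry p q i j)
    (@mxentry_is_linear p q i j).

Lemma colmx_of_mul (L : {linear 'cV[R]_m -> 'cV[R]_m}) w : colmx_of L *m w = L w.
Proof.
apply/colP => i; rewrite mxE [in RHS](matrix_sum_delta w) linear_sum summxE.
apply: eq_bigr => j _; rewrite big_ord1 linearZ !mxE mulrC.
by [].
Qed.

Lemma colmx_of_mulmx (A : 'M[R]_m) : colmx_of (mulmx A) = A.
Proof. by apply/matrixP => i j; rewrite mxE -colE mxE. Qed.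

End ColumnMatrix.

(** * Connections in a chart *)

Section ChartCalculus.
Context {R : realType} {m : nat} {M : smooth_manifold R m}.
Implicit Types (x y p : M) (v w z : 'cV[R]_m).
Implicit Types (Y Z : M -> 'cV[R]_m) (sigma : M -> 'M[R]_m) (f : M -> R).
Implicit Types (nabla : connection M).

Lemma cfrom_atK x p : cdom_at x p -> cfrom_at x (cto_at x p) = p.
Proof. exact: ctoK. Qed.

Lemma near_cfrom_at x p (P : M -> Prop) : cdom_at x p ->
  (\forall q \near p, P q) -> \forall z \near cto_at x p, P (cfrom_at x z).
Proof.
move=> xp Pp.
have fc : cfrom_at x @ cto_at x p --> cfrom_at x (cto_at x p).
  by apply: cfrom_continuous; exists p.
by rewrite cfrom_atK // in fc; exact: fc.
Qed.

Lemma near_cdom_at x p : cdom_at x p -> \forall q \near p, cdom_at x q.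
Proof. by move=> xp; apply: open_nbhs_nbhs; split=> //; exact: cdom_open. Qed.

Lemma near_cto_atK x p : cdom_at x p ->
  \forall z \near cto_at x p, cdom_at x (cfrom_at x z) /\ cto_at x (cfrom_at x z) = z.
Proof.
move=> xp; have : \forall z \near cto_at x p, (cto_at x @` cdom_at x) z.
  by apply: open_nbhs_nbhs; split; [exact: cimg_open|exists p].
by apply: filterS => z [q xq <-]; rewrite cfrom_atK.
Qed.

Lemma cdom_at_center x : cdom_at x x. Proof. exact: chart_atP. Qed.
Hint Resolve cdom_at_center : core.

Lemma cfrom_at_center x : cfrom_at x (cto_at x x) = x.
Proof. exact: cfrom_atK. Qed.

Lemma is_diff_transition x y p : cdom_at x p -> cdom_at y p ->
  is_diff (cto_at x p) (cto_at y \o cfrom_at x)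
    ('d (cto_at y \o cfrom_at x) (cto_at x p)).
Proof.
move=> xp yp; apply: differentiableP.
by apply: ((chart_compat x y 1%N).1); exists p.
Qed.

Lemma colmx_of_id : colmx_of (@id 'cV[R]_m) = 1%:M.
Proof.
by apply/matrixP => i j; rewrite !mxE eqxx andbT.
Qed.

(** The two transition maps are inverse to each other near the point, so the
    chain rule makes their Jacobians inverse. *)
Lemma cchange_mul x y p : cdom_at x p -> cdom_at y p ->
  cchange y x p *m cchange x y p = 1%:M.
Proof.
move=> xp yp; apply/matrixP => i j.
have dxy := is_diff_transition xp yp; have dyx := is_diff_transition yp xp.
have fxp : (cto_at y \o cfrom_at x) (cto_at x p) = cto_at y p.
  by rewrite /= cfrom_atK.
have dcomp := @is_diff_comp _ _ _ _ _ _ (cto_at x \o cfrom_at y)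
  ('d (cto_at x \o cfrom_at y) (cto_at y p)) _ dxy.
rewrite fxp in dcomp; have {}dcomp := dcomp dyx.
have idE : \forall z \near cto_at x p,
    ((cto_at x \o cfrom_at y) \o (cto_at y \o cfrom_at x)) z = id z.
  apply: filterS2 (near_cto_atK xp) (near_cfrom_at xp (near_cdom_at yp)) => z.
  by move=> [_ xz] yz /=; rewrite cfrom_atK.
have idd := is_diffE (is_diff_id (cto_at x p)).
have idc := is_diffE (is_diff_near_eq idE dcomp).
have /(congr1 (@colmx_of R m)) := etrans (esym idc) idd.
rewrite colmx_of_id => <-.
rewrite [in LHS]mxE [in RHS]mxE /= -colmx_of_mul [in RHS]mxE.
apply: eq_bigr => k _.
by rewrite /cchange; congr (_ * _); rewrite [LHS]mxE.
Qed.

Lemma cchange_refl x p : cdom_at x p -> cchange x x p = 1%:M.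
Proof.
move=> xp; rewrite /cchange -colmx_of_id; congr colmx_of.
have idE : \forall z \near cto_at x p, id z = (cto_at x \o cfrom_at x) z.
  by apply: filterS (near_cto_atK xp) => z [_ xz] /=.
exact: (is_diffE (is_diff_near_eq idE (is_diff_id _))).
Qed.

Lemma vext_center x w : vext x w x = w.
Proof. by rewrite /vext cchange_refl // mul1mx. Qed.

Lemma vloc_center x Y : vloc x Y (cto_at x x) = Y x.
Proof. by rewrite /vloc /vcoord cfrom_at_center cchange_refl // mul1mx. Qed.

Lemma eloc_center x sigma : eloc x sigma (cto_at x x) = sigma x.
Proof.
by rewrite /eloc /ecoord cfrom_at_center cchange_refl // mul1mx mulmx1.
Qed.

(** [vext x w] has constant components in the chart at [x]: this makes it
    smooth, and makes the brackets of such fields vanish. *)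
Lemma near_vloc_vext x w : \forall z \near cto_at x x, vloc x (vext x w) z = w.
Proof.
apply: filterS (near_cto_atK (cdom_at_center x)) => z [xz _].
by rewrite /vloc /vcoord /vext mulmxA cchange_mul // mul1mx.
Qed.

Lemma vsmooth_vext x w : vsmooth_at x (vext x w).
Proof.
apply: (smooth_at_near_eq (f := fun=> w)); last exact: smooth_at_cst.
by apply: filterS (near_vloc_vext x w) => z ->.
Qed.

Lemma vsmooth_at_add x Y Z :
  vsmooth_at x Y -> vsmooth_at x Z -> vsmooth_at x (fun y => Y y + Z y).
Proof.
move=> Ys Zs; rewrite /vsmooth_at; have := smooth_at_add Ys Zs.
apply: smooth_at_eq => z.
by rewrite /vloc /vcoord mulmxDr.
Qed.

Lemma vsmooth_at_scale x f Y :
  fsmooth_at x f -> vsmooth_at x Y -> vsmooth_at x (fun y => f y *: Y y).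
Proof.
move=> fs Ys; rewrite /vsmooth_at; have := smooth_at_scale fs Ys.
apply: smooth_at_eq => z.
by rewrite /vloc /vcoord /floc scalemxAr.
Qed.

Lemma esmooth_at_add x s s' :
  esmooth_at x s -> esmooth_at x s' -> esmooth_at x (fun y => s y + s' y).
Proof.
move=> Ys Zs; rewrite /esmooth_at; have := smooth_at_add Ys Zs.
apply: smooth_at_eq => z.
by rewrite /eloc /ecoord mulmxDr mulmxDl.
Qed.

Lemma esmooth_at_scale x f s :
  fsmooth_at x f -> esmooth_at x s -> esmooth_at x (fun y => f y *: s y).
Proof.
move=> fs Ys; rewrite /esmooth_at; have := smooth_at_scale fs Ys.
apply: smooth_at_eq => z.
by rewrite /eloc /ecoord /floc -scalemxAr -scalemxAl.
Qed.

Lemma fsmooth_at_cst x (a : R) : fsmooth_at x (fun=> a).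
Proof. exact: smooth_at_cst. Qed.

Lemma fderiv_cst x (a : R) v : fderiv x (fun=> a) v = 0.
Proof. by rewrite /fderiv /floc diff_cst. Qed.

Lemma vloc_mulmx_vext x sigma w z :
  vloc x (fun y => sigma y *m vext x w y) z = eloc x sigma z *m w.
Proof. by rewrite /vloc /vcoord /eloc /ecoord /vext !mulmxA. Qed.

Lemma vsmooth_mulmx_vext x sigma w :
  esmooth_at x sigma -> vsmooth_at x (fun y => sigma y *m vext x w y).
Proof.
move=> ss; have := smooth_at_linear (L := mulmxr w)
  (@matrix_linear_continuous _ _ _ _ _) ss.
apply: smooth_at_eq => z.
by rewrite vloc_mulmx_vext.
Qed.

Lemma vsmooth_at0 x : vsmooth_at x (fun=> 0 : 'cV[R]_m).
Proof.
have := smooth_at_cst (0 : 'cV[R]_m) (cto_at x x).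
by apply: smooth_at_eq => z; rewrite /vloc /vcoord mulmx0.
Qed.

Lemma cov0 nabla x v : cov nabla x v (fun=> 0) = 0.
Proof.
have s0 := vsmooth_at0 x.
apply: (addrI (cov nabla x v (fun=> 0))); rewrite addr0 -cov_add //.
by congr cov; apply/funext => y; rewrite addr0.
Qed.

Lemma cov_sum nabla x v (I : Type) (r : seq I) (Y : I -> M -> 'cV[R]_m) :
  (forall i, vsmooth_at x (Y i)) ->
  vsmooth_at x (fun y => \sum_(i <- r) Y i y) /\
  cov nabla x v (fun y => \sum_(i <- r) Y i y) = \sum_(i <- r) cov nabla x v (Y i).
Proof.
move=> Ys; elim: r => [|i r [IHs IHc]].
  rewrite big_nil -[RHS](cov0 nabla x v).
  have -> : (fun y => \sum_(i <- [::]) Y i y) = fun=> 0.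
    by apply/funext => y; rewrite big_nil.
  by split=> //; exact: vsmooth_at0.
have -> : (fun y => \sum_(j <- i :: r) Y j y) =
    fun y => Y i y + \sum_(j <- r) Y j y.
  by apply/funext => y; rewrite big_cons.
split; first exact: vsmooth_at_add.
by rewrite big_cons cov_add // IHc.
Qed.

(** The connection form in the chart at [x]: the endomorphism [w |-> nabla_v W]
    where [W] has constant components [w]. *)
Definition christoffel nabla x v : 'M[R]_m :=
  colmx_of (fun w => cov nabla x v (vext x w)).

Lemma cov_vext_linear nabla x v : linear (fun w => cov nabla x v (vext x w)).
Proof.
move=> a w w' /=.
have -> : vext x (a *: w + w') = fun y => a *: vext x w y + vext x w' y.
  by apply/funext => y; rewrite /vext mulmxDr -scalemxAr.
have cs : fsmooth_at x (fun=> a) by exact: fsmooth_at_cst.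
have ws := @vsmooth_vext x w; have ws' := @vsmooth_vext x w'.
rewrite cov_add //; last exact: vsmooth_at_scale.
by rewrite (cov_leibniz nabla v cs ws) fderiv_cst scale0r add0r.
Qed.

Lemma christoffel_mul nabla x v w :
  christoffel nabla x v *m w = cov nabla x v (vext x w).
Proof.
pose LM := GRing.isLinear.Build _ _ _ _ _ (@cov_vext_linear nabla x v).
pose L : {linear 'cV[R]_m -> 'cV[R]_m} :=
  HB.pack (fun w => cov nabla x v (vext x w)) LM.
exact: (colmx_of_mul L w).
Qed.

(** Near [x] the field is the combination of the coordinate fields of the
    chart, with its components as coefficients; locality, additivity and the
    Leibniz rule then compute the derivative from its values on the coordinate
    fields. *)
Lemma cov_chart nabla x v Y : vsmooth_at x Y ->
  cov nabla x v Y = 'd (vloc x Y) (cto_at x x) v + christoffel nabla x v *m Y x.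
Proof.
move=> Ys; have Yd := smooth_at_is_diff Ys.
pose comp i y := mxentry i 0 (vloc x Y (cto_at x y)).
have ec i : continuous (@mxentry R m 1 i 0).
  exact: matrix_linear_continuous.
have locE i : \forall z \near cto_at x x,
    (mxentry i 0 \o vloc x Y) z = floc x (comp i) z.
  apply: filterS (near_cto_atK (cdom_at_center x)) => z [_ xz].
  by rewrite /floc /comp /= xz.
have cs i : fsmooth_at x (comp i).
  apply: smooth_at_near_eq (locE i) _.
  by apply: smooth_at_linear => //; exact: ec.
have cd i : fderiv x (comp i) v = ('d (vloc x Y) (cto_at x x) v) i 0.
  have cd := is_diff_linear_comp (ec i) Yd.
  by rewrite /fderiv (is_diffE (is_diff_near_eq (locE i) cd)).
have Es i : vsmooth_at x (fun y => comp i y *: vext x (delta_mx i 0) y).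
  by apply: vsmooth_at_scale => //; exact: vsmooth_vext.
have [Ss Sc] := cov_sum nabla v (index_enum 'I_m) Es.
have YE : \forall y \near x,
    Y y = \sum_i comp i y *: vext x (delta_mx i 0) y.
  apply: filterS (near_cdom_at (cdom_at_center x)) => y xy.
  under eq_bigr do rewrite /vext scalemxAr.
  rewrite -mulmx_sumr.
  have <- : vloc x Y (cto_at x y) = \sum_i comp i y *: delta_mx i 0.
    by rewrite [LHS]matrix_sum_delta; apply: eq_bigr => i _; rewrite big_ord1.
  by rewrite /vloc /vcoord cfrom_atK // mulmxA cchange_mul // mul1mx.
rewrite (cov_local nabla v Ys Ss YE) Sc.
under eq_bigr => i _ do rewrite (cov_leibniz nabla v (cs i) (vsmooth_vext x _)).
rewrite big_split /=; congr (_ + _).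
  rewrite [RHS]matrix_sum_delta; apply: eq_bigr => i _.
  by rewrite big_ord1 vext_center cd.
rewrite [in RHS](matrix_sum_delta (Y x)) mulmx_sumr; apply: eq_bigr => i _.
by rewrite big_ord1 -scalemxAr christoffel_mul /comp vloc_center.
Qed.

(** The flat derivative of the chart at [x]; the induced connection adds to it
    the commutator with the connection form. *)
Definition ederiv x sigma v : 'M[R]_m := 'd (eloc x sigma) (cto_at x x) v.

Lemma ecov_chart nabla x v sigma : esmooth_at x sigma ->
  ecov nabla x v sigma = ederiv x sigma v
    + (christoffel nabla x v *m sigma x - sigma x *m christoffel nabla x v).
Proof.
move=> ss; have sd := smooth_at_is_diff ss.
rewrite /ederiv -[RHS]colmx_of_mulmx; congr colmx_of; apply/funext => w.
rewrite cov_chart; last exact: vsmooth_mulmx_vext.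
rewrite vext_center -christoffel_mul mulmxDl mulmxBl !mulmxA addrA.
congr (_ + _ - _).
have -> : vloc x (fun y => sigma y *m vext x w y) = mulmxr w \o eloc x sigma.
  by apply/funext => z; rewrite vloc_mulmx_vext.
have wc : continuous (mulmxr w : 'M[R]_m -> 'cV[R]_m).
  exact: matrix_linear_continuous.
by rewrite (is_diffE (is_diff_linear_comp wc sd)).
Qed.

Lemma lie_bracket_vext x v w : lie_bracket (vext x v) (vext x w) x = 0.
Proof.
have d0 (u u' : 'cV[R]_m) : 'd (vloc x (vext x u)) (cto_at x x) u' = 0.
  have uE : \forall z \near cto_at x x, cst u z = vloc x (vext x u) z.
    by apply: filterS (near_vloc_vext x u) => z ->.
  have d0 := is_diffE (is_diff_near_eq uE (is_diff_cst u (cto_at x x))).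
  exact: (congr1 (fun g => g u') d0).
apply/eqP; rewrite subr_eq0; apply/eqP.
by transitivity (0 : 'cV[R]_m); [exact: d0|symmetry; exact: d0].
Qed.

(** The torsion is evaluated on fields with constant components, whose bracket
    vanishes. *)
Lemma torsion_christoffel nabla x v w :
  torsion nabla x v w = christoffel nabla x v *m w - christoffel nabla x w *m v.
Proof.
by rewrite /torsion /torsion_fields !vext_center -!christoffel_mul
  lie_bracket_vext subr0.
Qed.

Lemma christoffel_linear nabla x : linear (christoffel nabla x).
Proof.
move=> a v w; apply/matrixP => i j; rewrite !mxE cov_linear ?mxE //.
exact: vsmooth_vext.
Qed.

End ChartCalculus.
#[global] Hint Resolve cdom_at_center : core.

(** * Linear algebra of a quaternionic structure on a vector space *)

Section QuaternionAlgebra.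
Context {R : realType} {m : nat}.
Implicit Types (A B J K : 'M[R]_m) (v w : 'cV[R]_m).

Definition quaternion_triple K1 K2 K3 : Prop :=
  [/\ K1 *m K1 = - 1%:M, K2 *m K2 = - 1%:M, K3 *m K3 = - 1%:M,
      K1 *m K2 = K3 & K2 *m K1 = - K3].

Definition qspan K1 K2 K3 : set 'M[R]_m :=
  [set A | exists a b c : R, A = a *: K1 + b *: K2 + c *: K3].

(** The quaternion product of two imaginary quaternions: minus the scalar
    product plus the vector product. *)
Lemma qspan_mul K1 K2 K3 (a b c a' b' c' : R) : quaternion_triple K1 K2 K3 ->
  (a *: K1 + b *: K2 + c *: K3) *m (a' *: K1 + b' *: K2 + c' *: K3) =
  (- (a * a' + b * b' + c * c')) *: 1%:M + (b * c' - c * b') *: K1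
    + (c * a' - a * c') *: K2 + (a * b' - b * a') *: K3.
Proof.
move=> [K11 K22 K33 K12 K21].
have K31 : K3 *m K1 = K2.
  by rewrite -K12 -mulmxA K21 mulmxN -K12 mulmxA K11 mulNmx mul1mx opprK.
have K13 : K1 *m K3 = - K2 by rewrite -K12 mulmxA K11 mulNmx mul1mx.
have K32 : K3 *m K2 = - K1 by rewrite -K12 -mulmxA K22 mulmxN mulmx1.
have K23 : K2 *m K3 = K1 by rewrite -[in LHS]K12 mulmxA K21 mulNmx K32 opprK.
rewrite !(mulmxDl, mulmxDr) -!(scalemxAl, scalemxAr).
rewrite K11 K12 K13 K21 K22 K23 K31 K32 K33.
by move: 1%:M => I; apply/matrixP => i j; rewrite !mxE; ring.
Qed.

Lemma qspan_sqr K1 K2 K3 (a b c : R) : quaternion_triple K1 K2 K3 ->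
  let A := a *: K1 + b *: K2 + c *: K3 in
  A *m A = (- (a ^+ 2 + b ^+ 2 + c ^+ 2)) *: 1%:M.
Proof.
move=> K /=; rewrite qspan_mul //.
by move: 1%:M => I; apply/matrixP => i j; rewrite !mxE; ring.
Qed.

Lemma qspan_sqr_le0 K1 K2 K3 A : quaternion_triple K1 K2 K3 ->
  qspan K1 K2 K3 A -> exists2 c : R, 0 <= c /\ (c = 0 -> A = 0) &
    A *m A = (- c) *: 1%:M.
Proof.
move=> K [a [b [c ->]]]; exists (a ^+ 2 + b ^+ 2 + c ^+ 2); last first.
  exact: qspan_sqr.
split; first by rewrite !addr_ge0 // sqr_ge0.
move=> /eqP; rewrite !paddr_eq0 ?addr_ge0 ?sqr_ge0 // !sqrf_eq0.
by move=> /andP[/andP[/eqP-> /eqP->] /eqP->]; rewrite !scale0r !addr0.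
Qed.

Lemma qspan_lin K1 K2 K3 (a : R) A B :
  qspan K1 K2 K3 A -> qspan K1 K2 K3 B -> qspan K1 K2 K3 (a *: A + B).
Proof.
move=> [a1 [b1 [c1 ->]]] [a2 [b2 [c2 ->]]].
exists (a * a1 + a2), (a * b1 + b2), (a * c1 + c2).
by apply/matrixP => i j; rewrite !mxE; ring.
Qed.

Definition commx A B : 'M[R]_m := A *m B - B *m A.

Lemma qspan_commx K1 K2 K3 A B : quaternion_triple K1 K2 K3 ->
  qspan K1 K2 K3 A -> qspan K1 K2 K3 B -> qspan K1 K2 K3 (commx A B).
Proof.
move=> K [a [b [c ->]]] [a' [b' [c' ->]]].
exists (2 * (b * c' - c * b')), (2 * (c * a' - a * c')), (2 * (a * b' - b * a')).
rewrite /commx !qspan_mul //.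
by move: 1%:M => I; apply/matrixP => i j; rewrite !mxE; ring.
Qed.

(** This is the term by which [I_1] depends on the connection form [G], see
    [twistor_I1E]. *)
Definition twist_obstruction J (G : 'cV[R]_m -> 'M[R]_m) v : 'M[R]_m :=
  commx (G (J *m v)) J - J *m commx (G v) J.

Lemma commx_subl A B J : commx (A - B) J = commx A J - commx B J.
Proof. by rewrite /commx mulmxBl mulmxBr !opprB !addrA [LHS](ACl (1*4*3*2)). Qed.

Lemma twist_obstruction_sub J (G G' : 'cV[R]_m -> 'M[R]_m) v :
  twist_obstruction J (fun u => G u - G' u) v =
  twist_obstruction J G v - twist_obstruction J G' v.
Proof.
rewrite /twist_obstruction !commx_subl mulmxBr.
move: (commx (G (J *m v)) J) (commx (G' (J *m v)) J) => a a'.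
move: (J *m commx (G v) J) (J *m commx (G' v) J) => b b'.
by rewrite !opprB !addrA [LHS](ACl (1*4*3*2)).
Qed.

(** [commx A J] anticommutes with [J]. This matters because it writes the
    product as a commutator: [Q] is closed under commutators but not under
    products. *)
Lemma mulmx_commx_anti J A : J *m J = - 1%:M ->
  J *m commx A J = 2^-1 *: commx J (commx A J).
Proof.
move=> JJ; have anti : commx A J *m J = - (J *m commx A J).
  rewrite /commx mulmxBl mulmxBr -!mulmxA JJ !mulmxA JJ mulmxN mulmx1 mulNmx.
  by rewrite mul1mx opprB.
have half : 2^-1 + 2^-1 = 1 :> R by field.
by rewrite [in RHS]/commx -/(commx A J) anti opprK scalerDr -scalerDl half scale1r.
Qed.

Lemma twist_obstruction_qspan K1 K2 K3 J (G : 'cV[R]_m -> 'M[R]_m) v :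
  quaternion_triple K1 K2 K3 -> qspan K1 K2 K3 J -> J *m J = - 1%:M ->
  (forall u, qspan K1 K2 K3 (commx (G u) J)) ->
  qspan K1 K2 K3 (twist_obstruction J G v).
Proof.
move=> K KJ JJ KG; rewrite /twist_obstruction mulmx_commx_anti // addrC -scaleNr.
by apply: qspan_lin => //; exact: qspan_commx.
Qed.

(** A nonzero [P v] is invertible with square a negative scalar. For the [w]
    with [P v w = v], symmetry makes [v] an eigenvector of [P w] for the
    eigenvalue 1, whereas the square of [P w] is a nonpositive scalar. *)
Lemma symmetric_qspan_eq0 K1 K2 K3 (P : 'cV[R]_m -> 'M[R]_m) :
  quaternion_triple K1 K2 K3 -> (forall v, qspan K1 K2 K3 (P v)) ->
  (forall v w, P v *m w = P w *m v) -> forall v, P v = 0.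
Proof.
move=> K KP Psym v.
have [c [c0 cP] Pc] := qspan_sqr_le0 K (KP v).
have [/cP //|cN0] := eqVneq c 0.
(* [P v] has inverse [- c^-1 *: P v] by its square. *)
have vE : P v *m (- c^-1 *: (P v *m v)) = v.
  rewrite -scalemxAr mulmxA Pc -scalemxAl mul1mx scalerA mulrNN mulVf //.
  by rewrite scale1r.
rewrite Psym in vE; set w := _ *: _ in vE.
have [d [d0 _] Pd] := qspan_sqr_le0 K (KP w).
have : (1 + d) *: v = 0.
  rewrite scalerDl scale1r -[X in X + _]vE -[X in P w *m X]vE mulmxA Pd.
  by rewrite -scalemxAl mul1mx scaleNr addNr.
move=> /eqP; rewrite scaler_eq0 gt_eqF ?ltr_wpDr //= => /eqP v0.
(* Here [v = 0], and symmetry makes [P v] kill every vector. *)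
apply/matrixP => i j; have := Psym v (delta_mx j 0).
by rewrite [in RHS]v0 mulmx0 -colE => /colP/(_ i); rewrite !mxE.
Qed.

(** Of the eight terms, those with [G] at [J v] or at [v] combine to [P v w],
    the others to [- P w v]. *)
Lemma part02_torsion J (G : 'cV[R]_m -> 'M[R]_m) v w :
  J *m J = - 1%:M ->
  part02 J (fun u u' => G u *m u' - G u' *m u) v w =
  4%:R^-1 *: (twist_obstruction J G v *m w - twist_obstruction J G w *m v).
Proof.
move=> JJ; rewrite /part02 /twist_obstruction /commx; congr (_ *: _).
rewrite !(mulmxBl, mulmxBr, mulmxA) JJ !mulNmx !mul1mx !opprB !opprK !addrA.
by rewrite [LHS](ACl (1*6*4*8*5*3*7*2)).
Qed.

End QuaternionAlgebra.

(** * Horizontal lifts, twistor structures and torsion *)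

Section QuaternionicGeometry.
Context {R : realType} {m : nat} {M : smooth_manifold R m}.
Context {Q : M -> set 'M[R]_m} (Q_aq : almost_quaternionic Q).
Implicit Types (x y : M) (v w : 'cV[R]_m) (A J : 'M[R]_m).
Implicit Types (sigma tau : M -> 'M[R]_m) (f : M -> R).
Implicit Types (nabla : connection M).

Lemma eloc_add x sigma tau :
  eloc x (fun y => sigma y + tau y) = fun z => eloc x sigma z + eloc x tau z.
Proof. by apply/funext => z; rewrite /eloc /ecoord mulmxDr mulmxDl. Qed.

Lemma eloc_scale x f sigma :
  eloc x (fun y => f y *: sigma y) = fun z => floc x f z *: eloc x sigma z.
Proof.
by apply/funext => z; rewrite /eloc /ecoord /floc -scalemxAr -scalemxAl.
Qed.

Lemma floc_center x f : floc x f (cto_at x x) = f x.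
Proof. by rewrite /floc cfrom_at_center. Qed.

Lemma ederiv_add x v sigma tau : esmooth_at x sigma -> esmooth_at x tau ->
  ederiv x (fun y => sigma y + tau y) v = ederiv x sigma v + ederiv x tau v.
Proof.
move=> ss ts; rewrite /ederiv (eloc_add x sigma tau).
exact: (congr1 (fun h => h v)
  (is_diffE (is_diffD (smooth_at_is_diff ss) (smooth_at_is_diff ts)))).
Qed.

Lemma ederiv_scale x v f sigma : fsmooth_at x f -> esmooth_at x sigma ->
  ederiv x (fun y => f y *: sigma y) v =
  f x *: ederiv x sigma v + fderiv x f v *: sigma x.
Proof.
move=> fs ss; rewrite -(floc_center x f) -(eloc_center x sigma).
rewrite /ederiv /fderiv (eloc_scale x f sigma).
exact: (congr1 (fun h => h v)
  (is_diffE (is_diff_scale (smooth_at_is_diff fs) (smooth_at_is_diff ss)))).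
Qed.

Lemma ecov_add nabla x v sigma tau :
  esmooth_at x sigma -> esmooth_at x tau ->
  ecov nabla x v (fun y => sigma y + tau y) =
  ecov nabla x v sigma + ecov nabla x v tau.
Proof.
move=> ss ts; rewrite !ecov_chart //; last exact: esmooth_at_add.
rewrite ederiv_add // mulmxDr mulmxDl.
by rewrite opprD [X in _ + X]addrACA [LHS]addrACA.
Qed.

Lemma ecov_scale nabla x v f sigma :
  fsmooth_at x f -> esmooth_at x sigma ->
  ecov nabla x v (fun y => f y *: sigma y) =
  fderiv x f v *: sigma x + f x *: ecov nabla x v sigma.
Proof.
move=> fs ss; rewrite !ecov_chart //; last exact: esmooth_at_scale.
rewrite ederiv_scale // -scalemxAr -scalemxAl -scalerBr.
by rewrite [X in _ = _ + X]scalerDr addrA; congr (_ + _); rewrite addrC.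
Qed.

Lemma quaternion_triple_at x :
  exists K1 K2 K3, quaternion_triple K1 K2 K3 /\ Q x = qspan K1 K2 K3.
Proof.
have [U [_ Ux] [J1 [J2 [J3 /(_ _ Ux)]]]] := Q_aq x.
by move=> [_ [J11 J22 J33] J12 J21 ->]; exists (J1 x), (J2 x), (J3 x).
Qed.

Lemma fiber_linear x (a : R) A B : Q x A -> Q x B -> Q x (a *: A + B).
Proof.
have [K1 [K2 [K3 [_ ->]]]] := quaternion_triple_at x; exact: qspan_lin.
Qed.

Lemma fiber_commx x A B : Q x A -> Q x B -> Q x (commx A B).
Proof.
have [K1 [K2 [K3 [K ->]]]] := quaternion_triple_at x; exact: qspan_commx.
Qed.

Lemma local_section_add_scale x f sigma tau :
  fsmooth_at x f -> local_section Q x sigma -> local_section Q x tau ->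
  local_section Q x (fun y => sigma y + f y *: tau y).
Proof.
move=> fs [ss sQ] [ts tQ]; split.
  by apply: esmooth_at_add => //; exact: esmooth_at_scale.
by apply: filterS2 sQ tQ => y sy ty; rewrite addrC; exact: fiber_linear.
Qed.

(** Constant coefficients in a local admissible basis: the square is then the
    same scalar at all points, so a section through a point of the twistor
    space stays in the twistor space. *)
Lemma local_section_through x A : Q x A ->
  exists sigma, [/\ local_section Q x sigma, sigma x = A &
    \forall y \near x, sigma y *m sigma y = A *m A].
Proof.
have [U [oU Ux] [J1 [J2 [J3 UJ]]]] := Q_aq x.
have [[J1s J2s J3s] [J11 J22 J33] J12 J21 Qx] := UJ x Ux.
rewrite {1}Qx => -[a [b [c AE]]].
exists (fun y => a *: J1 y + b *: J2 y + c *: J3 y); split => //.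
- split; last first.
    apply: filterS (open_nbhs_nbhs (conj oU Ux)) => y Uy.
    by have [_ _ _ _ ->] := UJ y Uy; exists a, b, c.
  apply: esmooth_at_add; last by apply: esmooth_at_scale => //; exact: fsmooth_at_cst.
  by apply: esmooth_at_add; apply: esmooth_at_scale => //; exact: fsmooth_at_cst.
- apply: filterS (open_nbhs_nbhs (conj oU Ux)) => y Uy.
  have [_ [H1 H2 H3] H4 H5 _] := UJ y Uy.
  by rewrite AE !qspan_sqr.
Qed.

Lemma christoffel0 nabla x : christoffel nabla x 0 = 0.
Proof.
have := christoffel_linear nabla x 1 0 0.
by rewrite !scale1r addr0 => /eqP; rewrite -subr_eq subrr => /eqP.
Qed.

(** A multiple of a coordinate function in which [v] has a nonzero component,
    shifted to vanish at [x]. *)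
Lemma exists_fderiv x v (a : R) : v != 0 ->
  exists f, [/\ fsmooth_at x f, f x = 0 & fderiv x f v = a].
Proof.
move=> /eqP vN0.
have [i vi] : exists i, v i 0 != 0.
  apply/not_existsP => v0; apply: vN0; apply/colP => i; rewrite mxE.
  by have /negP := v0 i; rewrite negbK => /eqP.
pose L : {linear 'cV[R]_m -> R} := (a / v i 0) \*: mxentry i 0.
have Lc : continuous L by exact: matrix_linear_continuous.
pose g z := - L (cto_at x x) + L z.
have gE : \forall z \near cto_at x x, g z = floc x (g \o cto_at x) z.
  apply: filterS (near_cto_atK (cdom_at_center x)) => z [_ xz].
  by rewrite /floc /= xz.
exists (g \o cto_at x); split.
- by apply: smooth_at_near_eq gE _; exact: smooth_at_cst_add_linear.
- by rewrite /= /g addNr.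
- rewrite /fderiv.
  have gd := is_diff_cst_add_linear (- L (cto_at x x)) (cto_at x x) Lc.
  have := congr1 (fun h => h v) (is_diffE (is_diff_near_eq gE gd)) => /= ->.
  by rewrite /mxentry /GRing.scale /= divfK.
Qed.

Lemma part02_torsion_obstruction nabla x J v w : J *m J = - 1%:M ->
  part02 J (torsion nabla x) v w = 4%:R^-1 *:
    (twist_obstruction J (christoffel nabla x) v *m w
     - twist_obstruction J (christoffel nabla x) w *m v).
Proof.
move=> JJ; have -> : torsion nabla x =
    fun u u' => christoffel nabla x u *m u' - christoffel nabla x u' *m u.
  by apply/funext => u; apply/funext => u'; exact: torsion_christoffel.
exact: part02_torsion.
Qed.

(** Two quaternionic connections differ on a section of [Q] through [A] by this
    commutator, both derivatives being in [Q]. *)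
Lemma christoffel_sub_commx nabla nabla' x v A :
  quaternionic_connection Q nabla -> quaternionic_connection Q nabla' ->
  Q x A -> Q x (commx (christoffel nabla x v - christoffel nabla' x v) A).
Proof.
move=> nq nq' /local_section_through [sigma [sQ sx _]].
have := fiber_linear (-1) (nq' x v sigma sQ) (nq x v sigma sQ).
rewrite !ecov_chart; [|exact: sQ.1|exact: sQ.1].
rewrite sx commx_subl -/(commx _ A) -/(commx _ A).
move: (commx (_ nabla x v) A) (commx (_ nabla' x v) A) (ederiv _ _ _) => a a' b.
by rewrite scaleN1r opprD [- b - _]addrC -addrA addKr addrC.
Qed.

Section HorizontalLift.
Context (nabla : connection M) (nabla_q : quaternionic_connection Q nabla).

(** Start from any section through [A], with derivative [B] in [Q], and
    subtract a section through [B] times a function that vanishes at [x] and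
    has derivative 1 along [v]. *)
Lemma parallel_section x v A : Q x A -> exists sigma,
  [/\ local_section Q x sigma, sigma x = A & ecov nabla x v sigma = 0].
Proof.
move=> QA; have [sigma [sQ sx _]] := local_section_through QA.
(* No function has a nonzero derivative along the zero vector. *)
have [->|vN0] := eqVneq v 0.
  exists sigma; split => //; rewrite ecov_chart; last exact: sQ.1.
  by rewrite /ederiv linear0 christoffel0 mul0mx mulmx0 subrr addr0.
have [tau [tQ tx _]] := local_section_through (nabla_q v sQ).
have [f [fs fx fv]] := exists_fderiv x (-1) vN0.
exists (fun y => sigma y + f y *: tau y); split.
- exact: local_section_add_scale.
- by rewrite sx fx scale0r addr0.
- rewrite ecov_add; [|exact: sQ.1|by apply: esmooth_at_scale => //; exact: tQ.1].
  rewrite ecov_scale //; last exact: tQ.1.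
  by rewrite fx fv tx scale0r addr0 scaleN1r subrr.
Qed.

(** Along a section parallel at [x], the flat derivative is minus the
    commutator with the connection form; so the horizontal lift does not depend
    on the section, and [parallel_section] provides one. *)
Lemma hliftE x J v : Q x J ->
  hlift Q nabla x J v = (v, - commx (christoffel nabla x v) J).
Proof.
move=> QJ; rewrite /hlift.
have [|[sigma [sQ sx scov hE]] h1] := @xgetPex _ (v, 0)
    [set xi | horizontal Q nabla x J xi /\ xi.1 = v].
  have [sigma [sQ sx scov]] := parallel_section v QJ.
  by exists (section_diff x sigma v); split => //; exists sigma.
rewrite h1 in scov hE.
rewrite hE /section_diff; congr pair.
move: scov; rewrite ecov_chart; last exact: sQ.1.
by rewrite sx => /eqP; rewrite addr_eq0 => /eqP.
Qed.

Lemma twistor_I1E x J (xi : etangent R m) : Q x J ->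
  twistor_I1 Q nabla x J xi =
  (J *m xi.1, J *m xi.2 - twist_obstruction J (christoffel nabla x) xi.1).
Proof.
move=> QJ; rewrite /twistor_I1 !hliftE //; congr pair => /=; first by rewrite add0r.
rewrite /twist_obstruction opprK mulmxDr.
move: (commx _ J) (J *m commx _ J) => C C'.
by rewrite opprB addrA.
Qed.

End HorizontalLift.

(** The velocity of a section with values in the twistor space along a straight
    line of the chart. *)
Lemma twistor_tangent_over x J v : twistor Q x J ->
  exists2 xi, twistor_tangent Q x J xi & xi.1 = v.
Proof.
move=> [QJ JJ]; have [sigma [[ss sQ] sx s2]] := local_section_through QJ.
have Llin : linear (fun t : R => t *: v).
  by move=> a s t; rewrite scalerDl scalerA.
pose LM := GRing.isLinear.Build _ _ _ _ _ Llin.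
pose L : {linear R -> 'cV[R]_m} := HB.pack (fun t : R => t *: v) LM.
have Lc : continuous L by move=> t; apply: cvgZr_tmp; exact: cvg_id.
pose z t := cto_at x x + L t.
have z0 : z 0 = cto_at x x by rewrite /z linear0 addr0.
have zd := is_diff_cst_add_linear (cto_at x x) (0 : R) Lc.
have zc : z @ (0 : R) --> cto_at x x.
  by rewrite -[X in _ --> X]z0; apply: differentiable_continuous; case: zd.
pose g t := cfrom_at x (z t); pose c t := sigma (g t).
have zE : \forall t \near (0 : R), z t = cto_at x (g t).
  have : \forall t \near (0 : R), cdom_at x (g t) /\ cto_at x (g t) = z t.
    exact: (zc _ (near_cto_atK (cdom_at_center x))).
  by apply: filterS => t [].
have gP (P : M -> Prop) : (\forall y \near x, P y) -> \forall t \near (0 : R), P (g t).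
  by move=> Px; apply: (zc _ (near_cfrom_at (cdom_at_center x) Px)).
exists (derive1 (fun t : R => cto_at x (g t)) 0,
        derive1 (fun t : R => ecoord x (g t) (c t)) 0).
  exists g, c; split => //.
  - by rewrite /g z0 cfrom_at_center.
  - by rewrite /c /g z0 cfrom_at_center.
  - have := gP _ (near_cdom_at (cdom_at_center x)).
    have := gP _ sQ; have := gP _ s2; apply: filterS3 => t s2t sQt xt.
    by split => //; split=> //; rewrite s2t.
  - split.
      apply: smooth_at_near_eq zE _; exact: smooth_at_cst_add_linear.
    apply: (smooth_at_comp_affine (f := eloc x sigma) (a := cto_at x x)) => //.
    by rewrite linear0 addr0.
rewrite /=.
have [gd gv] := is_diff_near_eq zE zd.
by rewrite derive1E' // gv /= scale1r.
Qed.

End QuaternionicGeometry.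

(** The implication from (ii) to (i) at one point of the twistor space. *)
Lemma twist_obstruction_eq (R : realType) (m : nat) (M : smooth_manifold R m)
    (Q : M -> set 'M[R]_m) (nabla nabla' : connection M) (x : M) (J : 'M[R]_m) :
  almost_quaternionic Q -> quaternionic_connection Q nabla ->
  quaternionic_connection Q nabla' -> twistor Q x J ->
  (forall v w, part02 J (torsion nabla x) v w = part02 J (torsion nabla' x) v w) ->
  forall v, twist_obstruction J (christoffel nabla x) v =
            twist_obstruction J (christoffel nabla' x) v.
Proof.
move=> Q_aq nq nq' [QJ JJ] Teq v.
pose P u := twist_obstruction J
  (fun u' => christoffel nabla x u' - christoffel nabla' x u') u.
have Psym u w : P u *m w = P w *m u.
  have four_neq0 : (4%:R^-1 : R) != 0 by rewrite invr_eq0 pnatr_eq0.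
  (* Collect the terms applied to [w] on one side. *)
  have swap (a b c d : 'cV[R]_m) : a - b = c - d -> a - c = b - d.
    move=> e; rewrite -[a](subrK b) e [LHS](ACl (1*4*3*2)) /=.
    by rewrite subrr add0r.
  have := Teq u w; rewrite !(part02_torsion_obstruction _ _ _ _ JJ).
  move=> /(scalerI four_neq0) /swap e.
  by rewrite /P !twist_obstruction_sub [LHS]mulmxBl [RHS]mulmxBl.
have [K1 [K2 [K3 [K QE]]]] := quaternion_triple_at Q_aq x.
apply/eqP; rewrite -subr_eq0 -twist_obstruction_sub; apply/eqP.
apply: (symmetric_qspan_eq0 (P := P) K) => // u.
apply: twist_obstruction_qspan => //; rewrite -QE // => u'.
exact: christoffel_sub_commx.
Qed.

Theorem corollary3p3 (R : realType) (n : nat) (n_gt0 : (0 < n)%N)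
  (M : smooth_manifold R (4 * n)) (Q : M -> set 'M[R]_(4 * n))
  (Q_aq : almost_quaternionic Q)
  (nabla nabla' : connection M)
  (nabla_q : quaternionic_connection Q nabla)
  (nabla'_q : quaternionic_connection Q nabla')
  (nabla_neq : ~ same_connection nabla nabla') :
  (forall (x : M) (J : 'M[R]_(4 * n)) (xi : etangent R (4 * n)),
     twistor Q x J -> twistor_tangent Q x J xi ->
     twistor_I1 Q nabla x J xi = twistor_I1 Q nabla' x J xi)
  <->
  (forall (x : M) (J : 'M[R]_(4 * n)), twistor Q x J ->
     forall X Y : 'cV[R]_(4 * n),
       part02 J (torsion nabla x) X Y = part02 J (torsion nabla' x) X Y).
Proof.
split=> [I1eq x J ZJ X Y|Teq x J xi ZJ _]; last first.
  rewrite (twistor_I1E Q_aq nabla_q _ ZJ.1) (twistor_I1E Q_aq nabla'_q _ ZJ.1).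
  by rewrite (twist_obstruction_eq Q_aq nabla_q nabla'_q ZJ (Teq x J ZJ)).
have obstr v : twist_obstruction J (christoffel nabla x) v =
    twist_obstruction J (christoffel nabla' x) v.
  have [xi xiT <-] := twistor_tangent_over Q_aq v ZJ.
  have := I1eq x J xi ZJ xiT.
  rewrite (twistor_I1E Q_aq nabla_q _ ZJ.1) (twistor_I1E Q_aq nabla'_q _ ZJ.1).
  by move=> /(congr1 snd) /= /addrI /oppr_inj.
by rewrite !(part02_torsion_obstruction _ _ _ _ ZJ.2) !obstr.
Qed.
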